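(* There exists a constant $C>0$ such that $$R_{\mathrm{ind}}(H;r)\le r^{Crk}$$ for every integer $r\ge 2$ and every graph $H$ on $k$ vertices.
   Context: For a graph $H$ and an integer $r\ge 1$, the $r$-colour induced Ramsey number $R_{\mathrm{ind}}(H;r)$ is the minimum number of vertices of a graph $G$ such that every colouring $c:E(G)\to[r]=\{1,\dots,r\}$ of the edges of $G$ admits a set $L\subset V(G)$ with $G[L]\cong H$ (an induced copy of $H$ in $G$) all of whose edges receive the same colour under $c$. *)

(* Defs.v *)
From mathcomp Require Import all_boot.
From Stdlib Require Export Reals.
Set Implicit Arguments. Unset Strict Implicit. Unset Printing Implicit Defensive.

Definition simple_graph (n : nat) (e : rel 'I_n) : Prop :=
  symmetric e /\ irreflexive e.

(* An r-edge-colouring of G: a symmetric colour function on pairs of vertices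
   (only its values on edges of G matter). Colours are 'I_r = {0,...,r-1}. *)
Definition edge_colouring (n r : nat) (c : 'I_n -> 'I_n -> 'I_r) : Prop :=
  forall x y, c x y = c y x.

Definition induced_embedding (k n : nat) (H : rel 'I_k) (G : rel 'I_n)
  (f : 'I_k -> 'I_n) : Prop :=
  injective f /\ forall i j, G (f i) (f j) = H i j.

Definition induced_ramsey (k n r : nat) (H : rel 'I_k) (G : rel 'I_n) : Prop :=
  forall c : 'I_n -> 'I_n -> 'I_r, edge_colouring c ->
    exists f : 'I_k -> 'I_n, induced_embedding H G f /\
      exists col : 'I_r, forall i j, H i j -> c (f i) (f j) = col.

(* R_ind(H;r) <= N  iff  some graph on at most N vertices is r-induced-Ramsey
   for H (R_ind is the minimum such number of vertices). *)
Definition Rind_le (k r : nat) (H : rel 'I_k) (N : R) : Prop :=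
  exists n : nat, (INR n <= N)%R /\
    exists G : rel 'I_n, simple_graph G /\ induced_ramsey r H G.

(* Main.v *)
(** The host graph [G] is the inner product graph on F_2^d: by Lindsey's lemma all
    pairs of large vertex sets span about half of the possible edges and half of the
    possible non-edges.

    Fix an r-colouring of [G]. For a set [F] of pairs (colour, vertex of H), let
    [weight F] count the pairs [(x, y)] where, for every colour, [x] embeds the
    corresponding part of [F] as an induced copy in that colour, and each of the
    [s = 2rk] points of [y] is joined to every point of [x] in the colour of the latter
    (so copies are weighted by the s-th power of their common neighbourhood).
    Choose [F] maximising [b^(2|F|) * weight F]. If some colour is complete in [F] we
    are done. Otherwise, since [weight F] is a high moment, it is dominated by copies
    with a large common neighbourhood [X]; picking [w] in [X] and its majority colour
    towards [X] adds a vertex [w] joined to everything in the right colour. The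
    edges from [w] that should be non-edges of [H] are then exchanged one at a time:
    once all points but [w] and one [x u] are fixed, these two range over a product
    of two sets, in which [G] has about half of the pairs as non-edges. The
    error of an exchange is controlled by [weight (F :\ u)], which is at most
    [b^2 * weight F] by maximality of [F]. The outcome contradicts maximality. *)
From mathcomp Require Import all_boot all_order all_algebra zify lra.
Require Import Defs.
From Stdlib Require Import Reals.
From mathcomp Require Import ssrnat.
Set Implicit Arguments. Unset Strict Implicit. Unset Printing Implicit Defensive.

(** * Edge density and resampling of coordinates *)

Definition edge_dense (V : finType) (E : nat) (D : rel V) : Prop :=
  forall A B : {set V},
    #|A| * #|B| <= 2 * (\sum_(a in A) \sum_(b in B) D a b) + E.

Section Update.
Variables I V : finType.
Implicit Types (x : {ffun I -> V}) (u v : I) (a b : V).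

Definition upd x u a : {ffun I -> V} := [ffun i => if i == u then a else x i].

Lemma updE x u a i : upd x u a i = if i == u then a else x i.
Proof. by rewrite ffunE. Qed.

Lemma upd_id x u a : upd x u a u = a.
Proof. by rewrite updE eqxx. Qed.

Lemma upd_neq x u a i : i != u -> upd x u a i = x i.
Proof. by rewrite updE => /negbTE->. Qed.

Lemma updC x u v a b : u != v -> upd (upd x u a) v b = upd (upd x v b) u a.
Proof.
move=> uv; apply/ffunP => i; rewrite !updE.
by case: (i =P v) => // ->; rewrite eq_sym (negbTE uv).
Qed.

(** Swapping [x u] with [a] is an involution on the pairs [(x, a)]. *)
Lemma sum_upd u (f : {ffun I -> V} -> nat) :
  \sum_x \sum_a f (upd x u a) = #|V| * \sum_x f x.
Proof.
rewrite pair_big /=.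
pose s (p : {ffun I -> V} * V) := (upd p.1 u p.2, p.1 u).
have sK : involutive s.
  case=> x a; rewrite /s /= upd_id; congr pair.
  by apply/ffunP => i; rewrite !updE; case: eqP => // ->.
rewrite (reindex_inj (inv_inj sK)) /=.
rewrite (eq_bigr (fun p => f p.1)); last first.
  by move=> p _; congr f; have := congr1 fst (sK p).
rewrite -(pair_big xpredT xpredT (fun x a => f x)) /= big_distrr /=.
by apply: eq_bigr => x _; rewrite sum_nat_const.
Qed.

Lemma sum_upd2 u v (f : {ffun I -> V} -> nat) :
  \sum_x \sum_a \sum_b f (upd (upd x u a) v b) = #|V| ^ 2 * \sum_x f x.
Proof.
rewrite (sum_upd u (fun x => \sum_b f (upd x v b))) sum_upd mulnA.
by rewrite expnS expn1.
Qed.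

(** With all coordinates but [u] and [v] fixed, [A] constrains only [x u] and [B] only [x v], so
    they cut out a product set to which [edge_dense] applies. The error [E], a fraction [1 / g] of
    all pairs, is paid only where [C] holds. *)
Lemma edge_dense_sum (E g : nat) (D : rel V) u v (A B C : pred {ffun I -> V}) :
  edge_dense E D -> 0 < E -> #|V| ^ 2 = E * g -> u != v ->
  (forall x b, A (upd x v b) = A x) ->
  (forall x a, B (upd x u a) = B x) ->
  (forall x a, C (upd x u a) = C x) -> (forall x b, C (upd x v b) = C x) ->
  g * \sum_x [&& C x, A x & B x]
    <= 2 * g * (\sum_x [&& C x, A x, B x & D (x u) (x v)]) + \sum_x C x.
Proof.
move=> dD E0 VE uv Av Bu Cu Cv.
rewrite -(leq_pmul2l E0) mulnDr mulnA -VE.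
rewrite (_ : E * (2 * g * _) = 2 * (#|V| ^ 2 *
  \sum_x [&& C x, A x, B x & D (x u) (x v)])); last by rewrite VE; lia.
rewrite -!(sum_upd2 u v) !big_distrr -big_split /=; apply: leq_sum => x _.
pose A' := [set a | A (upd x u a)]; pose B' := [set b | B (upd x v b)].
have [Cx|/negbTE Cx] := boolP (C x); last first.
  by rewrite big1 // => a _; rewrite big1 // => b _; rewrite Cv Cu Cx.
have eA a b : A (upd (upd x u a) v b) = (a \in A') by rewrite inE Av.
have eB a b : B (upd (upd x u a) v b) = (b \in B') by rewrite inE updC // Bu.
have eD a b : upd (upd x u a) v b u = a by rewrite upd_neq // upd_id.
have -> : \sum_a \sum_b [&& C (upd (upd x u a) v b), A (upd (upd x u a) v b)
    & B (upd (upd x u a) v b)] = #|A'| * #|B'|.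
  rewrite -!sum1_card big_distrl [RHS]big_mkcond /=; apply: eq_bigr => a _.
  rewrite mul1n; case: ifP => aA.
    rewrite [RHS]big_mkcond /=; apply: eq_bigr => b _.
    by rewrite Cv Cu Cx eA eB aA; case: (b \in B').
  by rewrite big1 // => b _; rewrite Cv Cu Cx eA aA.
have -> : \sum_a \sum_b [&& C (upd (upd x u a) v b), A (upd (upd x u a) v b),
    B (upd (upd x u a) v b) & D (upd (upd x u a) v b u) (upd (upd x u a) v b v)]
    = \sum_(a in A') \sum_(b in B') D a b.
  rewrite [RHS]big_mkcond /=; apply: eq_bigr => a _; case: ifP => aA.
    rewrite [RHS]big_mkcond /=; apply: eq_bigr => b _.
    by rewrite Cv Cu Cx eA eB eD upd_id aA; case: (b \in B').
  by rewrite big1 // => b _; rewrite Cv Cu Cx eA aA.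
by rewrite muln1; exact: dD.
Qed.

End Update.

(** * Moments of coloured neighbourhoods *)

Section Moment.
Variables (V : finType) (r : nat) (G : rel V) (c : V -> V -> 'I_r).

Definition cadj (col : 'I_r) : rel V := fun v w => G v w && (c v w == col).

Definition cnbr (col : 'I_r) (v : V) : {set V} := [set w | cadj col v w].

Lemma sum_cnbr (X : {set V}) :
  \sum_(w in X) \sum_(col < r) #|X :&: cnbr col w|
    = \sum_(w in X) \sum_(v in X) G w v.
Proof.
apply: eq_bigr => w _.
rewrite (eq_bigr (fun col => \sum_(v in X) cadj col w v)); last first.
  move=> col _; rewrite -sum1_card big_mkcond [RHS]big_mkcond /=.
  by apply: eq_bigr => v _; rewrite !inE; case: (v \in X); case: (cadj _ _ _).
rewrite exchange_big /=; apply: eq_bigr => v _.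
rewrite /cadj; case: (G w v) => /=; last by rewrite big1.
rewrite (bigD1 (c w v)) //= eqxx big1 // => i.
by rewrite eq_sym => /negbTE->.
Qed.

(* Termwise comparison of a ^ s with a multiple of a, in place of the power mean inequality. *)
Lemma moment_cnbr (E t s : nat) (X : {set V}) :
  0 < r -> 0 < t -> edge_dense E G -> 2 * E <= t ^ 2 ->
  t * #|X| ^ s <= 8 * (8 * r) ^ s *
     (\sum_(w in X) \sum_(col < r) #|X :&: cnbr col w| ^ s) + t ^ s.+1.
Proof.
move=> r0 t0 dG Et; set n := #|X|.
have [nt|tn] := ltnP n t.
  apply: (@leq_trans (t ^ s.+1)); last exact: leq_addl.
  rewrite expnS leq_mul2l; apply/orP; right.
  by case: (s) => // s'; rewrite leq_exp2r // ltnW.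
have n0 : 0 < n by apply: leq_trans tn.
apply: (@leq_trans (n ^ s.+1)).
  by rewrite expnS leq_mul2r tn orbT.
apply: (leq_trans _ (leq_addr _ _)).
set S := \sum_(w in X) _.
have := dG X X; rewrite -/n -sum_cnbr; set e := \sum_(w in X) _ => He.
(* Since [t <= n], the error [E] is at most half of [n * n]. *)
have n2 : n * n <= 4 * e.
  have : t * t <= n * n by exact: leq_mul.
  have : 2 * E <= t * t by move: Et; rewrite expnS expn1.
  lia.
have key (w : V) (col : 'I_r) : 8 * r * n ^ s * #|X :&: cnbr col w|
    <= 8 * r * n * ((8 * r) ^ s * #|X :&: cnbr col w| ^ s) + n ^ s.+1.
  set a := #|_|; have an : a <= n by rewrite /a subset_leq_card // subsetIl.
  rewrite -expnMn; have [na|an'] := leqP n (8 * r * a).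
    apply: (leq_trans _ (leq_addr _ _)).
    rewrite -!mulnA !leq_mul2l; apply/orP; right; apply/orP; right.
    rewrite [X in X <= _]mulnC; apply: leq_mul => //.
    by case: (s) => // s'; rewrite leq_exp2r // mulnA.
  apply: (leq_trans _ (leq_addl _ _)).
  rewrite mulnAC expnS leq_mul2r; apply/orP; right; exact: ltnW.
have : 8 * r * n ^ s * e <= 8 * r * n * ((8 * r) ^ s * S) + n * (r * n ^ s.+1).
  rewrite /e /S !big_distrr /=.
  have -> : n * (r * n ^ s.+1) = \sum_(w in X) \sum_(col < r) n ^ s.+1.
    by rewrite !sum_nat_const card_ord.
  rewrite -big_split /=; apply: leq_sum => w _.
  rewrite !big_distrr -big_split /=; apply: leq_sum => col _.
  exact: key.
rewrite expnS; move: (n ^ s) ((8 * r) ^ s) => p q Hk.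
(* Neighbourhoods smaller than [n / (8 * r)] account for at most [n * (r * (n * p))], half of the
   left side; hence the constant 8. *)
have h1 : 2 * r * p * (n * n) <= 8 * r * n * (q * S) + n * (r * (n * p)).
  apply: leq_trans Hk; rewrite (_ : 8 * r * p * e = 2 * r * p * (4 * e)); last by lia.
  by rewrite leq_mul2l n2 orbT.
have h2 : (r * n) * (n * p) <= (r * n) * (8 * q * S) by nia.
by move: h2; rewrite leq_pmul2l // muln_gt0 r0.
Qed.

End Moment.

(** * Weights of families of coloured partial copies *)

Section Ramsey.
Variables (V : finType) (r k s : nat) (G : rel V) (c : V -> V -> 'I_r).
Variable (H : rel 'I_k).
Hypotheses (Gsym : symmetric G) (Girr : irreflexive G).
Hypothesis csym : forall x y, c x y = c y x.
Hypothesis Hsym : symmetric H.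

(** Distinctness is built in so that copies are injective also across non-edges of [H]. *)
Definition nonadj : rel V := fun v w => (v != w) && ~~ G v w.

Let I : finType := ('I_r * 'I_k)%type.
Implicit Types (F S : {set I}) (x : {ffun I -> V}) (y : {ffun 'I_s -> V}).

Definition fits (col : 'I_r) (e : bool) : rel V :=
  if e then cadj G c col else nonadj.

Lemma fits_sym col e : symmetric (fits col e).
Proof.
move=> v w; rewrite /fits /cadj /nonadj.
by case: e; rewrite Gsym; [rewrite csym | rewrite eq_sym].
Qed.

Definition copy F x : bool :=
  [forall i in F, forall j in F, (i.1 == j.1) && (i != j) ==>
     fits i.1 (H i.2 j.2) (x i) (x j)].

Definition common F x : {set V} :=
  [set v | [forall i in F, cadj G c i.1 (x i) v]].

Definition good F x y : bool := copy F x && [forall l, y l \in common F x].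

(** Since [x] has a coordinate for every pair, also outside [F], all weights count in one space and
    compare without renormalisation by powers of [#|V|]. *)
Definition weight F : nat := \sum_x \sum_y good F x y.

Lemma copyP F x : reflect
  (forall i j, i \in F -> j \in F -> i.1 = j.1 -> i != j ->
     fits i.1 (H i.2 j.2) (x i) (x j)) (copy F x).
Proof.
apply: (iffP forall_inP) => [cF i j iF jF ij nij | cF i iF].
  by move: (cF i iF) => /forall_inP/(_ j jF)/implyP; apply; rewrite ij eqxx.
by apply/forall_inP => j jF; apply/implyP => /andP[/eqP ij nij]; apply: cF.
Qed.

Lemma commonP F x v : reflect
  (forall i, i \in F -> cadj G c i.1 (x i) v) (v \in common F x).
Proof. by rewrite inE; apply: forall_inP. Qed.

Lemma eq_copy F x x' : {in F, x =1 x'} -> copy F x = copy F x'.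
Proof.
by move=> e; apply/copyP/copyP => h i j iF jF; [rewrite -!e | rewrite !e] => //;
   apply: h.
Qed.

Lemma eq_common F x x' : {in F, x =1 x'} -> common F x = common F x'.
Proof.
move=> e; apply/setP => v; apply/commonP/commonP => h i iF;
  [rewrite -e | rewrite e] => //; exact: h.
Qed.

Lemma eq_good F x x' y : {in F, x =1 x'} -> good F x y = good F x' y.
Proof. by move=> e; rewrite /good (eq_copy e) (eq_common e). Qed.

Lemma upd_in F x u a : u \notin F -> {in F, upd x u a =1 x}.
Proof. by move=> uF i iF; rewrite upd_neq //; apply: contraNneq uF => <-. Qed.

Lemma good_subset F F' x y : F \subset F' -> good F' x y -> good F x y.
Proof.
move=> /subsetP sF /andP[/copyP cF /forallP yF]; apply/andP; split.
  by apply/copyP => i j /sF iF /sF jF; apply: cF.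
by apply/forallP => l; apply/commonP => i /sF iF; move/commonP: (yF l); apply.
Qed.

Lemma sum_forall_in (X : {set V}) :
  \sum_(y : {ffun 'I_s -> V}) [forall l, y l \in X] = #|X| ^ s.
Proof.
rewrite -[s in RHS]card_ord -card_ffun_on -sum1_card [RHS]big_mkcond /=.
by apply: eq_bigr => y _; case: forallP => /ffun_onP; case: (y \in _) => //.
Qed.

Lemma weight_common F : weight F = \sum_x copy F x * #|common F x| ^ s.
Proof.
apply: eq_bigr => x _; rewrite /good; case: (copy F x); last by rewrite big1.
by rewrite mul1n sum_forall_in.
Qed.

(** * Adding a vertex and exchanging edges for non-edges *)

Section Extension.
Variables (F : {set I}) (i0 : I).
Hypothesis i0F : i0 \notin F.

(* Interpolates, as S grows from set0 to F, between "x i0 is joined in its colour to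
   the whole copy of that colour" and "x i0 extends that copy as prescribed by H". *)
Definition link S x : bool :=
  [forall u in F, (u.1 == i0.1) ==>
     fits i0.1 (H u.2 i0.2 || (u \notin S)) (x u) (x i0)].

Definition ext S x y : bool :=
  [&& good F x y, [forall l, cadj G c i0.1 (x i0) (y l)] & link S x].

Definition ext_weight S : nat := \sum_x \sum_y ext S x y.

Lemma linkP S x : reflect
  (forall u, u \in F -> u.1 = i0.1 ->
     fits i0.1 (H u.2 i0.2 || (u \notin S)) (x u) (x i0)) (link S x).
Proof.
apply: (iffP forall_inP) => [h u uF e | h u uF].
  by move: (h u uF) => /implyP; apply; apply/eqP.
by apply/implyP => /eqP; apply: h.
Qed.

Lemma ext_weight_full : ext_weight F <= weight (i0 |: F).
Proof.
apply: leq_sum => x _; apply: leq_sum => y _.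
case: (boolP (ext F x y)) => // /and3P[/andP[/copyP cF /forallP yF]].
move=> /forallP y0 /linkP lF; rewrite lt0b; apply/andP; split.
  have l i : i \in F -> i.1 = i0.1 -> fits i0.1 (H i.2 i0.2) (x i) (x i0).
    by move=> iF e; have := lF i iF e; rewrite iF orbF.
  apply/copyP => i j; rewrite !in_setU1.
  move=> /predU1P[-> | iF] /predU1P[-> | jF]; first by rewrite eqxx.
  - by move=> e _; rewrite fits_sym Hsym; apply: l.
  - by move=> e _; rewrite e; apply: l.
  - exact: cF.
apply/forallP => l; apply/commonP => i; rewrite in_setU1.
by move=> /predU1P[-> | iF]; [exact: y0 | move/commonP: (yF l); apply].
Qed.

(** Only a non-edge of [H] in the colour of [i0] needs work. Without the condition between [x u] and
    [x i0], what remains is [good F], independent of [x i0], and [B], independent of [x u]. The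
    background condition [good (F :\ u)] is independent of both and turns the error into a
    weight. *)
Lemma ext_weight_step (E g : nat) S u :
  edge_dense E nonadj -> 0 < E -> #|V| ^ 2 = E * g -> u \in F -> u \notin S ->
  g * ext_weight S <= 2 * g * ext_weight (u |: S) + weight (F :\ u).
Proof.
move=> dD E0 VE uF uS.
have ui0 : u != i0 by apply: contraNneq i0F => <-.
have [triv | ] := boolP ((u.1 != i0.1) || H u.2 i0.2).
  have -> : ext_weight S = ext_weight (u |: S).
    apply: eq_bigr => x _; apply: eq_bigr => y _; congr (nat_of_bool _).
    congr [&& _, _ & _]; apply/linkP/linkP => h v vF e; have := h v vF e;
      rewrite in_setU1; case: (v =P u) => // evu; move: triv;
      by rewrite -evu e eqxx /= => ->.
  by rewrite -mulnA; apply: (leq_trans _ (leq_addr _ _)); rewrite mul2n -addnn leq_addr.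
rewrite negb_or negbK => /andP[/eqP eu nH].
rewrite /ext_weight /weight exchange_big [X in 2 * g * X]exchange_big.
rewrite [X in _ + X]exchange_big /= !big_distrr -big_split /=.
apply: leq_sum => y _.
pose B x := [forall l, cadj G c i0.1 (x i0) (y l)] &&
  [forall v in F :\ u, (v.1 == i0.1) ==>
     fits i0.1 (H v.2 i0.2 || (v \notin S)) (x v) (x i0)].
have := @edge_dense_sum I V E g nonadj u i0 (fun x => good F x y) B
  (fun x => good (F :\ u) x y) dD E0 VE ui0.
have hA x b : good F (upd x i0 b) y = good F x y.
  by apply: eq_good; apply: upd_in.
have hC1 x a : good (F :\ u) (upd x u a) y = good (F :\ u) x y.
  by apply: eq_good; apply: upd_in; rewrite in_setD1 eqxx.
have hC2 x a : good (F :\ u) (upd x i0 a) y = good (F :\ u) x y.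
  by apply: eq_good; apply: upd_in; rewrite in_setD1 negb_and i0F orbT.
have hB x a : B (upd x u a) = B x.
  rewrite /B upd_neq 1?eq_sym //; congr (_ && _).
  apply: eq_forallb => v; case: (boolP (v \in F :\ u)) => //.
  by rewrite in_setD1 => /andP[vu _]; rewrite upd_neq.
move=> /(_ hA hB hC1 hC2) main.
apply: leq_trans (leq_trans main _); last first.
  rewrite leq_add2r leq_mul2l; apply/orP; right.
  apply: leq_sum => x _.
  case: (boolP [&& _, _, _ & _]) => // /and4P[_ gF /andP[b1 /forall_inP b2] d].
  rewrite lt0b; apply/and3P; split => //; apply/linkP => v vF e.
  rewrite in_setU1; case: (v =P u) => [->|/eqP vu].
    by rewrite /= orbF (negbTE nH).
  have vFu : v \in F :\ u by rewrite in_setD1 vu.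
  by move/implyP: (b2 v vFu); apply; apply/eqP.
rewrite leq_mul2l; apply/orP; right; apply: leq_sum => x _.
case: (boolP (ext S x y)) => // /and3P[gF b1 /linkP b2].
rewrite lt0b; apply/and3P; split => //; first exact: good_subset (subsetDl _ _) gF.
apply/andP; split => //; apply/forall_inP => v; rewrite in_setD1 => /andP[_ vF].
by apply/implyP => /eqP e; apply: b2.
Qed.

(** Each exchange costs a factor 2 and an error [M]; the summand [M] inside the bracket lets the
    induction on [#|S|] absorb it. *)
Lemma ext_weight_chain (E g M : nat) S :
  edge_dense E nonadj -> 0 < E -> #|V| ^ 2 = E * g ->
  (forall u, u \in F -> weight (F :\ u) <= M) -> S \subset F ->
  g * ext_weight set0 <= 2 ^ #|S| * (g * ext_weight S + M).
Proof.
move=> dD E0 VE hM; move: {2}#|S| (erefl #|S|) => n.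
elim: n S => [|n IH] S Sn SF.
  by move/eqP: Sn; rewrite cards_eq0 => /eqP->; rewrite cards0 mul1n leq_addr.
have [u uS] : exists u, u \in S by apply/card_gt0P; rewrite Sn.
have uF : u \in F by apply: (subsetP SF).
have Sn' : #|S :\ u| = n by have := cardsD1 u S; rewrite uS Sn; lia.
have := IH (S :\ u) Sn' (subset_trans (subsetDl _ _) SF).
have := ext_weight_step dD E0 VE uF (_ : u \notin S :\ u).
rewrite in_setD1 eqxx setD1K // => /(_ isT) h1 h2.
rewrite Sn expnS; rewrite Sn' in h2; apply: leq_trans h2 _.
rewrite [2 * _]mulnC -mulnA leq_mul2l; apply/orP; right.
have := hM u uF; lia.
Qed.

End Extension.

(** * The moment bound and the maximality argument *)

Lemma weight_moment F (E t : nat) (j : 'I_r -> 'I_k) :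
  0 < r -> 0 < t -> edge_dense E G -> 2 * E <= t ^ 2 ->
  (forall col, (col, j col) \notin F) ->
  t * weight F <= 8 * (8 * r) ^ s * #|V| *
      (\sum_(col < r) ext_weight F (col, j col) set0)
    + t ^ s.+1 * #|V| ^ (r * k).
Proof.
move=> r0 t0 dG Et jF.
(* The vertex [w] is written into the coordinate [(col, j col)], free because it lies outside [F];
   the overwritten value accounts for [#|V|]. *)
have hext col : \sum_x copy F x * \sum_(w in common F x)
      #|common F x :&: cnbr G c col w| ^ s
    <= #|V| * ext_weight F (col, j col) set0.
  set i0 := (col, j col); rewrite -(sum_upd i0); apply: leq_sum => x _.
  case: (boolP (copy F x)) => // cF; rewrite mul1n big_mkcond /=.
  apply: leq_sum => w _; case: ifP => // wX.
  rewrite -sum_forall_in; apply: leq_sum => y _.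
  case: forallP => // yX; rewrite lt0b.
  have e := upd_in x w (jF col).
  apply/and3P; split; rewrite ?upd_id.
  - rewrite (eq_good _ e) /good cF; apply/forallP => l.
    by have := yX l; rewrite in_setI => /andP[].
  - by apply/forallP => l; have := yX l; rewrite in_setI => /andP[_]; rewrite inE.
  - apply/linkP => u uF eu; rewrite in_set0 orbT /= upd_id e //.
    by rewrite /= in eu; rewrite -eu; move/commonP: wX; apply.
rewrite -mulnA [#|V| * \sum_(_ < r) _]big_distrr /=.
apply: (@leq_trans (8 * (8 * r) ^ s * (\sum_(col < r) \sum_x copy F x *
    \sum_(w in common F x) #|common F x :&: cnbr G c col w| ^ s)
    + t ^ s.+1 * #|V| ^ (r * k))); last first.
  by rewrite leq_add2r leq_mul2l; apply/orP; right; apply: leq_sum => col _.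
rewrite exchange_big weight_common !big_distrr /=.
have -> : t ^ s.+1 * #|V| ^ (r * k) = \sum_(x : {ffun I -> V}) t ^ s.+1.
  by rewrite sum_nat_const card_ffun card_prod !card_ord mulnC.
rewrite -big_split /=; apply: leq_sum => x _.
case: (copy F x); last by rewrite muln0.
rewrite mul1n; apply: leq_trans (moment_cnbr c s (common F x) r0 t0 dG Et) _.
rewrite leq_add2r leq_mul2l exchange_big /=; apply/orP; right.
by apply: leq_sum => col _; rewrite mul1n.
Qed.

Lemma weight0 : weight set0 = #|V| ^ (r * k + s).
Proof.
rewrite weight_common (eq_bigr (fun=> #|V| ^ s)) => [|x _].
  by rewrite sum_nat_const card_ffun card_prod !card_ord expnD.
have -> : copy set0 x by apply/copyP => i j; rewrite in_set0.
suff -> : common set0 x = setT by rewrite cardsT mul1n.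
by apply/setP => v; rewrite in_setT; apply/commonP => i; rewrite in_set0.
Qed.

Lemma weight_copy F col :
  irreflexive H -> 0 < weight F -> (forall j, (col, j) \in F) ->
  exists f : 'I_k -> V, [/\ injective f, forall i j, G (f i) (f j) = H i j
    & forall i j, H i j -> c (f i) (f j) = col].
Proof.
move=> Hirr wF allF.
have [x xF] : exists x, copy F x.
  apply/existsP; apply: contraTT wF; rewrite negb_exists => /forallP nF.
  rewrite weight_common big1 // => x _; by rewrite (negbTE (nF x)).
exists (fun j => x (col, j)).
have h i j : i != j -> fits col (H i j) (x (col, i)) (x (col, j)).
  move=> ij; move/copyP: xF => /(_ (col, i) (col, j)); apply => //.
  by apply: contraNneq ij => -[->].
have hG i j : G (x (col, i)) (x (col, j)) = H i j.
  have [->|/h] := eqVneq i j; first by rewrite Girr Hirr.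
  by rewrite /fits; case: (H i j) => /andP[]// _ /negbTE.
split=> // i j => [e|Hij].
  apply/eqP/negPn/negP => /h; rewrite /fits e.
  by case: (H i j); rewrite /cadj /nonadj ?Girr ?eqxx.
have ij : i != j by apply: contraTneq Hij => ->; rewrite Hirr.
by have := h i j ij; rewrite /fits Hij => /andP[_ /eqP].
Qed.

(** Here [b ^ 2] is the price of one pair in [Phi], [t] the size below which a common neighbourhood
    is negligible, and [1 / g] the relative error of an exchange. *)
Lemma mono_copy (E g b t : nat) :
  0 < r -> 0 < k -> s = 2 * (r * k) -> irreflexive H ->
  edge_dense E G -> edge_dense E nonadj ->
  0 < E -> #|V| ^ 2 = E * g -> #|V| = 2 * b * t -> 0 < t -> 2 * E <= t ^ 2 ->
  64 * r * (8 * r) ^ s * 2 ^ (r * k) < b -> b ^ 4 <= g ->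
  exists col, exists f : 'I_k -> V,
    [/\ injective f, forall i j, G (f i) (f j) = H i j
      & forall i j, H i j -> c (f i) (f j) = col].
Proof.
move=> r0 k0 sE Hirr dG dD E0 VE VN t0 Et bB gb.
pose Phi F := (b ^ 2) ^ #|F| * weight F.
have [F _ Fmax] := @arg_maxnP _ set0 xpredT Phi isT.
have {}Fmax F' : Phi F' <= Phi F by apply: Fmax.
rewrite /Phi in Fmax; set W := weight F in Fmax.
have b0 : 0 < b by apply: leq_trans bB.
have b20 n : 0 < (b ^ 2) ^ n by rewrite !expn_gt0 b0.
have V0 : 0 < #|V| by rewrite VN !muln_gt0 b0.
have low : #|V| ^ (r * k + s) <= (b ^ 2) ^ (r * k) * W.
  rewrite -weight0; have := Fmax set0; rewrite cards0 mul1n => /leq_trans; apply.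
  rewrite leq_mul2r leq_pexp2l ?orbT ?expn_gt0 ?b0 //.
  by rewrite (leq_trans (max_card _)) // card_prod !card_ord.
have W0 : 0 < W.
  by rewrite lt0n; apply: contraTneq low => ->; rewrite muln0 -ltnNge expn_gt0 V0.
have [/existsP[col /forallP all_col]|none] :=
    boolP [exists col, [forall j, (col, j) \in F]].
  by exists col; apply: (weight_copy Hirr W0).
have ex col : exists j, (col, j) \notin F.
  move: none; rewrite negb_exists => /forallP/(_ col).
  by rewrite negb_forall => /existsP.
pose j col := xchoose (ex col).
have jF col : (col, j col) \notin F := xchooseP (ex col).
(* The choice [s = 2 * (r * k)] makes [#|V| ^ s] equal to [(4 * b ^ 2) ^ (r * k) * t ^ s]; this
   cancels the power of [b ^ 2] in [low] and leaves a factor of at least 4. *)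
have small : 2 * (t ^ s * #|V| ^ (r * k)) <= W.
  have e : #|V| ^ (r * k + s)
      = (b ^ 2) ^ (r * k) * (4 ^ (r * k) * (t ^ s * #|V| ^ (r * k))).
    rewrite expnD; move: (r * k) sE => m sE.
    have -> : #|V| ^ s = 4 ^ m * (b ^ 2) ^ m * t ^ s.
      by rewrite VN 2!expnMn {1 2}sE !expnM.
    by rewrite mulnC [4 ^ m * _]mulnC -!mulnA.
  move: low; rewrite e leq_pmul2l // => /(leq_trans _); apply.
  rewrite leq_mul2r; apply/orP; right.
  have : 4 ^ 1 <= 4 ^ (r * k) by rewrite leq_pexp2l // muln_gt0 r0.
  lia.
pose U col := ext_weight F (col, j col) set0.
have [col _ colmax] := @arg_maxnP _ (Ordinal r0) xpredT U isT.
have sumU : \sum_i U i <= r * U col.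
  rewrite -[r in X in _ <= X]card_ord -sum_nat_const.
  by apply: leq_sum => i _; apply: colmax.
(* By [small], the error term of [weight_moment] is at most half of [t * W]; together with
   [#|V| = 2 * b * t] this turns 8 into 32. *)
have WU : W <= 32 * (8 * r) ^ s * b * (r * U col).
  have := weight_moment r0 t0 dG Et jF; rewrite -/W -/U expnS {1}VN => mom.
  have ts := leq_mul (leqnn t) small.
  have : t * W <= t * (32 * (8 * r) ^ s * b * \sum_i U i).
    move: mom ts; move: ((8 * r) ^ s) (t ^ s) (#|V| ^ (r * k)) (\sum_i U i).
    by clear; move: W; lia.
  rewrite leq_pmul2l // => /leq_trans; apply.
  by rewrite leq_mul2l sumU orbT.
(* Maximality is used twice: at [F :\ u] it bounds the exchange error, and in [add], at [F] with a
   new pair, it bounds the outcome. *)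
have rem u : u \in F -> weight (F :\ u) <= b ^ 2 * W.
  move=> uF; have := Fmax (F :\ u); rewrite [X in _ <= _ ^ X * _](cardsD1 u) uF.
  by rewrite add1n [(b ^ 2) ^ _.+1]expnSr -mulnA leq_pmul2l.
have add : b ^ 2 * ext_weight F (col, j col) F <= W.
  apply: (@leq_trans (b ^ 2 * weight ((col, j col) |: F))).
    by rewrite leq_mul2l ext_weight_full orbT.
  have := Fmax ((col, j col) |: F); rewrite cardsU1 jF add1n.
  rewrite [(b ^ 2) ^ _.+1]expnSr -mulnA.
  by rewrite leq_pmul2l.
have := ext_weight_chain (jF col) dD E0 VE rem (subxx F).
rewrite -/(U col); set UF := ext_weight F _ F in add * => chain.
have {}chain : g * U col <= 2 ^ (r * k) * (g * UF + b ^ 2 * W).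
  apply: leq_trans chain _; rewrite leq_mul2r leq_pexp2l ?orbT //.
  by rewrite (leq_trans (max_card _)) // card_prod !card_ord.
have g0 : 0 < g by apply: leq_trans gb; rewrite expn_gt0 b0.
move: bB WU chain; set q := (8 * r) ^ s; set p := 2 ^ (r * k) => bB WU chain.
have h1 : 2 * (g * W) <= b * (64 * r * q * p) * (g * UF + b ^ 2 * W).
  apply: (@leq_trans (2 * (g * (32 * q * b * (r * U col))))).
    by rewrite !leq_mul2l WU !orbT.
  rewrite (_ : 2 * _ = 64 * r * q * b * (g * U col)); last by lia.
  rewrite (_ : _ * _ * (_ + _) = 64 * r * q * b * (p * (g * UF + b ^ 2 * W))); last by lia.
  by rewrite leq_mul2l chain orbT.
(* After multiplication by [b], both [g * (b ^ 2 * UF)] and [b ^ 4 * W] are at most [g * W], by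
   [add] and [gb]. *)
have h2 : b * (2 * (g * W)) <= (64 * r * q * p) * (2 * (g * W)).
  apply: (@leq_trans (b * (b * (64 * r * q * p) * (g * UF + b ^ 2 * W)))).
    by rewrite leq_mul2l h1 orbT.
  rewrite (_ : _ * _ = (64 * r * q * p) * (g * (b ^ 2 * UF) + b ^ 4 * W)); last by lia.
  rewrite leq_mul2l; apply/orP; right.
  rewrite mul2n -addnn leq_add // ?leq_mul2l ?add ?orbT //.
  by rewrite leq_mul2r gb orbT.
by move: h2; rewrite leq_pmul2r ?muln_gt0 ?g0 // leqNgt bB.
Qed.

End Ramsey.

(** * Discrepancy of the inner product graph *)

Section InnerProductGraph.
Import Order.TTheory GRing.Theory Num.Theory.
Variable d : nat.
Implicit Types a b : {ffun 'I_d -> bool}.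

Definition parity a b : bool := odd (\sum_i (a i && b i)).

Definition inner_graph : rel {ffun 'I_d -> bool} :=
  fun a b => (a != b) && parity a b.

Lemma inner_graph_sym : symmetric inner_graph.
Proof.
move=> a b; rewrite /inner_graph /parity eq_sym; congr (_ && odd _).
by apply: eq_bigr => i _; rewrite andbC.
Qed.

Lemma inner_graph_irr : irreflexive inner_graph.
Proof. by move=> a; rewrite /inner_graph eqxx. Qed.

Local Open Scope ring_scope.

Definition chi a b : int := (-1) ^+ parity a b.

Lemma chiE a b : chi a b = \prod_i (-1) ^+ (a i && b i).
Proof. by rewrite /chi /parity signr_odd expr_sum. Qed.

(** The sum factors over coordinates, and one where [b] and [b'] differ contributes [1 - 1]. *)
Lemma chi_orth b b' :
  \sum_a chi a b * chi a b' = (if b == b' then 2 ^+ d else 0).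
Proof.
under eq_bigr => a _ do rewrite !chiE -big_split /=.
rewrite -(bigA_distr_bigA (fun i e => (-1) ^+ (e && b i) * (-1) ^+ (e && b' i))).
case: eqP => [<-|/eqP nb].
  rewrite (eq_bigr (fun=> 2)) ?prodr_const ?card_ord // => i _.
  by rewrite big_bool /=; case: (b i).
have [i bi] : exists i, b i != b' i.
  apply/existsP; apply: contraNT nb; rewrite negb_exists => /forallP h.
  by apply/eqP/ffunP => i; apply/eqP; rewrite -[_ == _]negbK.
rewrite (bigD1 i) //= big_bool /=.
by case: (b i) (b' i) bi => [] []; rewrite // ?mulr1 ?mul1r addNr mul0r.
Qed.

Lemma chi_second_moment (B : {set {ffun 'I_d -> bool}}) :
  \sum_a (\sum_(b in B) chi a b) ^+ 2 = #|B|%:Z * 2 ^+ d.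
Proof.
under eq_bigr => a _ do rewrite expr2 big_distrlr /=.
rewrite exchange_big /=.
under eq_bigr => b bB.
  rewrite exchange_big /= (bigD1 b) //= chi_orth eqxx big1 ?addr0; last first.
    by move=> b' /andP[_ nb]; rewrite chi_orth eq_sym (negbTE nb).
  over.
by rewrite sumr_const -[LHS]mulr_natl natz.
Qed.

(* Lindsey's lemma, with AM-GM against 2 ^ h in place of Cauchy-Schwarz. *)
Lemma lindsey (h : nat) (e : bool) (A B : {set {ffun 'I_d -> bool}}) :
  d = (2 * h)%N ->
  - ((-1) ^+ e * \sum_(a in A) \sum_(b in B) chi a b) <= 2 ^+ (3 * h) :> int.
Proof.
move=> dh; pose f a := \sum_(b in B) chi a b; pose T : int := 2 ^+ h.
have T0 : 0 < T by rewrite exprn_gt0.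
have TE n : 2 ^+ (n * h) = T ^+ n :> int by rewrite mulnC exprM.
have dT : 2 ^+ d = T ^+ 2 :> int by rewrite -TE -dh.
have cV : #|{ffun 'I_d -> bool}|%:Z = T ^+ 2.
  by rewrite card_ffun card_bool card_ord -dT -natz natrX.
have cB : #|B|%:Z <= T ^+ 2 by rewrite -cV lez_nat max_card.
have cA : #|A|%:Z <= T ^+ 2 by rewrite -cV lez_nat max_card.
have s1 : \sum_(a in A) f a ^+ 2 <= T ^+ 4.
  apply: (@le_trans _ _ (\sum_a f a ^+ 2)).
    rewrite [X in _ <= X](bigID (mem A)) /= lerDl.
    by apply: sumr_ge0 => a _; apply: sqr_ge0.
  rewrite chi_second_moment dT; have := sqr_ge0 T; nia.
rewrite -(ler_pM2l (_ : 0 < 2 * T)) ?mulr_gt0 // TE.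
apply: (@le_trans _ _ (\sum_(a in A) (f a ^+ 2 + T ^+ 2))).
  rewrite mulr_sumr -sumrN mulr_sumr; apply: ler_sum => a _; rewrite -/(f a).
  rewrite -subr_ge0; have := sqr_ge0 (f a + (-1) ^+ e * T).
  by case: e; rewrite ?expr1 ?expr0; lra.
have cAT : \sum_(a in A) T ^+ 2 = #|A|%:Z * T ^+ 2.
  by rewrite sumr_const -[LHS]mulr_natl natz.
rewrite big_split /= cAT.
by have := ler_wpM2r (sqr_ge0 T) cA; move: s1; lra.
Qed.

(** The value [true] of [e] serves the graph, [false] its complement. As [2 * (parity a b == e)]
    equals [1 + (-1) ^+ e * chi a b], [lindsey] bounds the deviation. The diagonal costs at most
    [2 ^ (2 * h)] pairs, and [1 + 2 <= 4] gives the exponent [3 * h + 2]. *)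
Lemma edge_dense_parity (h : nat) (e : bool) (D : rel {ffun 'I_d -> bool}) :
  d = (2 * h)%N -> (forall a b, a != b -> D a b = (parity a b == e)) ->
  edge_dense (2 ^ (3 * h + 2)) D.
Proof.
move=> dh De A B.
have key : (#|A| * #|B|)%:Z <=
    2 * (\sum_(a in A) \sum_(b in B) (parity a b == e))%N%:Z + 2 ^+ (3 * h).
  have := lindsey e A B dh.
  suff -> : 2 * (\sum_(a in A) \sum_(b in B) (parity a b == e))%N%:Z =
    (#|A| * #|B|)%:Z + (-1) ^+ e * \sum_(a in A) \sum_(b in B) chi a b by lra.
  rewrite -sum1_card -sum1_card big_distrl /= !(big_morph Posz PoszD erefl).
  rewrite !big_distrr -big_split /=; apply: eq_bigr => a _.
  rewrite mul1n !(big_morph Posz PoszD erefl) !big_distrr -big_split /=.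
  by apply: eq_bigr => b _; rewrite /chi; case: (parity a b) (e) => [] [].
have diag : (\sum_(a in A) \sum_(b in B) (parity a b == e) <=
    \sum_(a in A) \sum_(b in B) D a b + 2 ^ (2 * h))%N.
  rewrite -dh -card_bool -[d in X in (_ <= _ + X)%N]card_ord -card_ffun -sum1_card.
  apply: (@leq_trans (\sum_(a in A) (\sum_(b in B) D a b + 1))%N).
    apply: leq_sum => a _; rewrite -(leq_add2r 0) addn0.
    apply: (@leq_trans (\sum_(b in B) (D a b + (b == a)))%N).
      apply: leq_sum => b _; case: (eqVneq b a) => [_|ba].
        by rewrite addn1; case: (_ == e).
      by rewrite De 1?eq_sym // addn0.
    rewrite big_split /= addn0 leq_add2l big_mkcond (bigD1 a) //= big1 => [|b ba].
      by rewrite eqxx; case: (a \in B).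
    by rewrite (negbTE ba); case: (b \in B).
  by rewrite big_split leq_add2l /= [X in (_ <= X)%N](bigID (mem A)) leq_addr.
have p1 : (2 ^ (2 * h) <= 2 ^ (3 * h))%N by rewrite leq_exp2l //; lia.
have p2 : 2 ^+ (3 * h) = (2 ^ (3 * h))%N%:Z by rewrite -natz natrX.
rewrite expnD; lia.
Qed.

End InnerProductGraph.

(** * Choice of parameters and the final bound *)

(** The exponent of [b] as a power of 2. As [r < 2 ^ l], the summands cover 64 (with one spare bit
    for strictness), [r], [(8 * r) ^ (2 * m)] and [2 ^ m]. *)
Definition ramsey_exp (r k : nat) : nat :=
  let l := (trunc_log 2 r).+1 in let m := r * k in
  7 + l + 2 * m * (3 + l) + m.

Lemma ramsey_exp_gt (r k : nat) : 1 < r -> 0 < k ->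
  64 * r * (8 * r) ^ (2 * (r * k)) * 2 ^ (r * k) < 2 ^ ramsey_exp r k.
Proof.
move=> r1 k0; rewrite /ramsey_exp; set l := (trunc_log 2 r).+1; set m := r * k.
have rl : r <= 2 ^ l by rewrite ltnW // trunc_log_ltn.
have r8 : (8 * r) ^ (2 * m) <= 2 ^ (2 * m * (3 + l)).
  rewrite [_ * (3 + l)]mulnC [2 ^ _]expnM leq_exp2r ?muln_gt0 ?k0 ?(ltnW r1) //.
  by rewrite expnD leq_mul2l rl orbT.
rewrite [2 ^ (_ + m)]expnD ltn_mul2r expn_gt0 /=.
rewrite [2 ^ (_ + _ * _)]expnD [2 ^ (7 + l)]expnD.
apply: (@leq_ltn_trans (64 * 2 ^ l * 2 ^ (2 * m * (3 + l)))).
  by apply: leq_mul => //; apply: leq_mul.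
by rewrite 2!ltn_mul2r !expn_gt0.
Qed.

(** With [l] and [m] positive, [ramsey_exp r k] is at most [17 * l * m], so the exponent is at most
    [(8 * 17 + 4) * l * m]; then [2 ^ l <= r ^ 2] doubles 140 to 280. *)
Lemma ramsey_size_le (r k : nat) : 1 < r -> 0 < k ->
  2 ^ (2 * (4 * ramsey_exp r k + 2)) <= r ^ (280 * (r * k)).
Proof.
move=> r1 k0; rewrite /ramsey_exp; set l := (trunc_log 2 r).+1; set m := r * k.
have m0 : 0 < m by rewrite muln_gt0 k0 ltnW.
have lr : 2 ^ l <= r ^ 2.
  rewrite -mulnn expnS; apply: leq_mul => //.
  by apply: trunc_logP => //; apply: ltnW.
apply: (@leq_trans (2 ^ (l * (140 * m)))).
  rewrite leq_exp2l //.
  have : 0 < l by [].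
  move: l {lr} => l l0; nia.
rewrite expnM (_ : 280 * m = 2 * (140 * m)); last by lia.
by rewrite [r ^ _]expnM leq_exp2r // muln_gt0.
Qed.

Lemma induced_ramsey_inner_graph (r k : nat) (H : rel 'I_k) :
  1 < r -> 0 < k -> simple_graph H ->
  let d := 2 * (4 * ramsey_exp r k + 2) in
  forall c : {ffun 'I_d -> bool} -> {ffun 'I_d -> bool} -> 'I_r,
  (forall x y, c x y = c y x) ->
  exists col, exists f : 'I_k -> {ffun 'I_d -> bool},
    [/\ injective f, forall i j, inner_graph (f i) (f j) = H i j
      & forall i j, H i j -> c (f i) (f j) = col].
Proof.
move=> r1 k0 [Hsym Hirr] d c csym; set e := ramsey_exp r k in d c csym *.
have cV : #|{: {ffun 'I_d -> bool}}| = 2 ^ d.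
  by rewrite card_ffun card_bool card_ord.
have dG := @edge_dense_parity d (4 * e + 2) true (@inner_graph d) erefl.
have dD := @edge_dense_parity d (4 * e + 2) false (nonadj (@inner_graph d)) erefl.
have e2 : 1 < e by [].
(* With [#|V| = 2 ^ (8 * e + 4)] and [E = 2 ^ (12 * e + 8)], the quotient [#|V| ^ 2 / E] is exactly
   [b ^ 4] for [b = 2 ^ e], and [#|V| = 2 * b * t] determines [t]. The condition [2 * E <= t ^ 2]
   reads [3 <= 2 * e], whence [e2]. *)
apply: (@mono_copy _ r k (2 * (r * k)) (@inner_graph d) c H _ _ csym Hsym
  (2 ^ (3 * (4 * e + 2) + 2)) (2 ^ (4 * e)) (2 ^ e) (2 ^ (7 * e + 3))) => //.
- exact: inner_graph_sym.
- exact: inner_graph_irr.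
- exact: ltnW.
- by apply: dG => a b ab; rewrite /inner_graph ab eqb_id.
- by apply: dD => a b ab; rewrite /nonadj /inner_graph ab eqbF_neg.
- by rewrite expn_gt0.
- by rewrite cV -expnM -expnD; congr (_ ^ _); rewrite /d; lia.
- by rewrite cV -expnS -expnD; congr (_ ^ _); rewrite /d; lia.
- by rewrite expn_gt0.
- by rewrite -expnS -expnM leq_exp2l //; lia.
- exact: ramsey_exp_gt.
- by rewrite -expnM mulnC.
Qed.

Lemma induced_ramsey_transfer (V : finType) (r k : nat) (G : rel V)
    (H : rel 'I_k) :
  (forall c : V -> V -> 'I_r, (forall x y, c x y = c y x) ->
    exists col, exists f : 'I_k -> V,
      [/\ injective f, forall i j, G (f i) (f j) = H i j
        & forall i j, H i j -> c (f i) (f j) = col]) ->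
  induced_ramsey r H (fun x y : 'I_#|V| => G (enum_val x) (enum_val y)).
Proof.
move=> ramG c csym.
have [//|col [f [finj fG fc]]] := ramG (fun v w => c (enum_rank v) (enum_rank w)).
exists (enum_rank \o f); split; last by exists col.
split; first exact: inj_comp enum_rank_inj finj.
by move=> i j; rewrite /= !enum_rankK.
Qed.

Lemma INR_expn (n m : nat) : INR (n ^ m) = pow (INR n) m.
Proof. by elim: m => [|m IH] //; rewrite expnS mult_INR IH. Qed.

Theorem theorem1p2 :
  exists C : R, (0 < C)%R /\
    forall (r k : nat), (2 <= r)%N ->
      forall H : rel 'I_k, simple_graph H ->
        Rind_le r H (Rpower (INR r) (C * INR r * INR k)).
Proof.
exists (INR 280); split; first by apply: lt_0_INR; apply/ltP.
move=> r k r2 H sH.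
have r0 : Rlt 0 (INR r) by apply: lt_0_INR; apply/ltP; apply: ltnW.
rewrite Rmult_assoc -!mult_INR Rpower_pow //.
have [k0|k0] := posnP k.
  (* For [k = 0] the graph without vertices is a host. *)
  exists 0; split; first by apply: pow_le; apply: Rlt_le.
  exists (fun _ _ => false); split=> // c _.
  have no_i : 'I_k -> False by rewrite k0; case.
  exists (fun i => match no_i i with end); split; last first.
    by exists (Ordinal (ltnW r2)) => i; case: (no_i i).
  by split=> i; case: (no_i i).
set d := 2 * (4 * ramsey_exp r k + 2).
exists #|{: {ffun 'I_d -> bool}}|; split.
  rewrite -INR_expn; apply: le_INR; apply/leP.
  by rewrite card_ffun card_bool card_ord; apply: ramsey_size_le.
exists (fun x y => inner_graph (enum_val x) (enum_val y)); split.
  by split=> [x y | x]; [exact: inner_graph_sym | exact: inner_graph_irr].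
apply: induced_ramsey_transfer; exact: induced_ramsey_inner_graph.
Qed.
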